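(* Let $n\ge 1$ be an integer, let $\mathbb K$ be a field, and let $G$ be a group that acts by isometries on a $1$-hyperbolic space with minimal displacement greater than $100\log_2((n+1)!)$. Then: 1. every $n$-generated (left) ideal in the group algebra $\mathbb K[G]$ is a free $\mathbb K[G]$-module; and 2. $\mathrm{GE}_n(\mathbb K[G])=\mathrm{GL}_n(\mathbb K[G])$.
   Context: Distances in a metric space are written $|p-q|$, and the Gromov product is $\langle p,q\rangle_r=\tfrac12(|p-r|+|q-r|-|p-q|)$. A $\delta$-hyperbolic space ($\delta\ge 0$) is a nonempty geodesic metric space such that (i) $\langle p,q\rangle_r\ge\min(\langle p,s\rangle_r,\langle s,q\rangle_r)-\delta$ for all points $p,q,r,s$; and (ii) all geodesic triangles are $\delta$-thin: if $p(t),q(t)$ are arc length parametrizations, starting at $r$, of geodesics $[r,p]$ and $[r,q]$, then $|p(t)-q(t)|\le\delta$ for $0\le t\le\langle p,q\rangle_r$. The minimal displacement of an isometric action of $G$ on $\mathcal H$ is $\inf_{g\in G\setminus\{1\},\,p\in\mathcal H}|g\cdot p-p|$. A module or ideal is $n$-generated if it can be generated by $n$ elements. For a ring $R$, $\mathrm{GE}_n(R)$ is the subgroup of $\mathrm{GL}_n(R)$ generated by the elementary matrices and the invertible diagonal matrices. *)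

(* Defs.v *)
From HB Require Import structures.
From mathcomp Require Import all_boot all_order all_algebra finmap.
From mathcomp Require Import monalg.
From mathcomp Require Import all_classical all_reals all_analysis.

Set Implicit Arguments.
Unset Strict Implicit.
Unset Printing Implicit Defensive.

Import GRing.Theory Num.Theory.

Local Open Scope classical_set_scope.
Local Open Scope ring_scope.

Section GroupAlgebra.
Local Open Scope fset_scope.
Variables (K : nzRingType) (G : groupType).
Local Notation KG := {malg K[G]}.
Implicit Types (x y z : KG) (g h : G).

Definition galg_one : KG := << 1 *g (1%g : G) >>.

Definition galg_mul x y : KG :=
  \sum_(g <- msupp x) \sum_(h <- msupp y) << x@_g * y@_h *g (g * h)%g >>.

Lemma galg_mulw (d1 d2 : {fset G}) x y :
  msupp x `<=` d1 -> msupp y `<=` d2 ->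
  galg_mul x y = \sum_(g <- d1) \sum_(h <- d2) << x@_g * y@_h *g (g * h)%g >>.
Proof.
move=> le_d1 le_d2; rewrite /galg_mul (big_fset_incl _ le_d1) /=.
  apply/eq_bigr=> k1 _; apply/big_fset_incl => // k _ /mcoeff_outdom ->.
  by rewrite mulr0 monalgU0.
move=> k _ /mcoeff_outdom g1k.
by rewrite big1 => // k' _; rewrite g1k mul0r monalgU0.
Qed.

Lemma galg_mulUU (a b : K) g h :
  galg_mul << a *g g >> << b *g h >> = << a * b *g (g * h)%g >>.
Proof. by rewrite (galg_mulw msuppU_le msuppU_le) !big_seq_fset1 !mcoeffUU. Qed.

Lemma galg_mul0l : left_zero 0 galg_mul.
Proof. by move=> x; rewrite /galg_mul msupp0 big_seq_fset0. Qed.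

Lemma galg_mul0r : right_zero 0 galg_mul.
Proof.
by move=> x; rewrite /galg_mul big1 // => k _; rewrite msupp0 big_seq_fset0.
Qed.

Lemma galg_mulDl : left_distributive galg_mul +%R.
Proof.
move=> x y z; have f := fsubset_refl (msupp z).
rewrite (galg_mulw (msuppD_le x y) f) (galg_mulw (fsubsetUl _ (msupp y)) f).
rewrite (galg_mulw (fsubsetUr (msupp x) _) f) -big_split /=.
apply/eq_bigr=> g _; rewrite -big_split /=; apply/eq_bigr=> h _.
by rewrite mcoeffD mulrDl monalgUD.
Qed.

Lemma galg_mulDr : right_distributive galg_mul +%R.
Proof.
move=> z x y; have f := fsubset_refl (msupp z).
rewrite (galg_mulw f (msuppD_le x y)) (galg_mulw f (fsubsetUl _ (msupp y))).
rewrite (galg_mulw f (fsubsetUr (msupp x) _)) -big_split /=.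
apply/eq_bigr=> g _; rewrite -big_split /=; apply/eq_bigr=> h _.
by rewrite mcoeffD mulrDr monalgUD.
Qed.

Lemma galg_mulUl (a : K) g x :
  galg_mul << a *g g >> x = \sum_(h <- msupp x) << a * x@_h *g (g * h)%g >>.
Proof.
rewrite (galg_mulw msuppU_le (fsubset_refl _)) big_seq_fset1.
by apply/eq_bigr => h _; rewrite mcoeffUU.
Qed.

Lemma galg_mulUr x (a : K) h :
  galg_mul x << a *g h >> = \sum_(g <- msupp x) << x@_g * a *g (g * h)%g >>.
Proof.
rewrite (galg_mulw (fsubset_refl _) msuppU_le).
by apply/eq_bigr => g _; rewrite big_seq_fset1 mcoeffUU.
Qed.

Lemma galg_mul1l : left_id galg_one galg_mul.
Proof.
move=> x; rewrite galg_mulUl [RHS]monalgE.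
by apply/eq_bigr=> g _; rewrite mul1r mul1g.
Qed.

Lemma galg_mul1r : right_id galg_one galg_mul.
Proof.
move=> x; rewrite galg_mulUr [RHS]monalgE.
by apply/eq_bigr=> g _; rewrite mulr1 mulg1.
Qed.

Lemma galg_suml (I : Type) (r : seq I) (F : I -> KG) y :
  galg_mul (\sum_(i <- r) F i) y = \sum_(i <- r) galg_mul (F i) y.
Proof.
exact: (big_morph (galg_mul^~ y) (fun _ _ => galg_mulDl _ _ _) (galg_mul0l y)).
Qed.

Lemma galg_sumr (I : Type) (r : seq I) (F : I -> KG) y :
  galg_mul y (\sum_(i <- r) F i) = \sum_(i <- r) galg_mul y (F i).
Proof.
exact: (big_morph (galg_mul y) (fun _ _ => galg_mulDr _ _ _) (galg_mul0r y)).
Qed.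

Lemma galg_mulA : associative galg_mul.
Proof.
move=> x y z; rewrite [x]monalgE !galg_suml; apply/eq_bigr=> g _.
rewrite [y]monalgE galg_sumr !galg_suml galg_sumr; apply/eq_bigr=> h _.
rewrite [z]monalgE !galg_sumr; apply/eq_bigr=> k _.
by rewrite !galg_mulUU mulrA mulgA.
Qed.

Lemma galg_one_neq0 : galg_one != 0.
Proof. by apply/eqP => /malgP /(_ 1%g) /eqP; rewrite mcoeffUU mcoeff0 oner_eq0. Qed.

End GroupAlgebra.

(* The finitely supported functions {malg K[G]} carry a ring structure in the
   library only when the monomials have no nontrivial units, which excludes
   groups; hence the alias below, with the convolution product. *)
Definition group_algebra (K : nzRingType) (G : groupType) : Type :=
  {malg K[G]}.

HB.instance Definition _ (K : nzRingType) (G : groupType) :=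
  GRing.Lmodule.copy (group_algebra K G) {malg K[G]}.
HB.instance Definition _ (K : nzRingType) (G : groupType) :=
  GRing.Zmodule_isNzRing.Build (group_algebra K G)
    (@galg_mulA K G) (@galg_mul1l K G) (@galg_mul1r K G)
    (@galg_mulDl K G) (@galg_mulDr K G) (galg_one_neq0 K G).

Section Modules.
Variables (A : nzRingType) (M : lmodType A).
Implicit Types (N B : set M).

Definition n_generated (n : nat) N : Prop :=
  exists x : 'I_n -> M,
    N = [set \sum_(i < n) a i *: x i | a in [set: 'I_n -> A]].

Definition is_basis N B : Prop :=
  [/\ B `<=` N,
      forall (F : {fset M}) (c : M -> A), [set` F] `<=` B ->
        \sum_(b <- F) c b *: b = 0 -> forall b, b \in F -> c b = 0
    & forall v, N v -> exists (F : {fset M}) (c : M -> A),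
        [set` F] `<=` B /\ v = \sum_(b <- F) c b *: b].

Definition free_submodule N : Prop := exists B, is_basis N B.

End Modules.

Definition left_ideal (A : nzRingType) (I : set A^o) : Prop :=
  submod_closed (mem I).

(* The library's unitmx and {'GL_n[R]} require a commutative coefficient ring. *)
Section GeneralLinear.
Variables (A : nzRingType) (n : nat).
Implicit Types (S : set 'M[A]_n).

Definition GL : set 'M[A]_n :=
  [set P | exists Q, P *m Q = 1%:M /\ Q *m P = 1%:M].

Definition elementary_mx (P : 'M[A]_n) : Prop :=
  exists (i j : 'I_n) (a : A), i != j /\ P = 1%:M + a *: delta_mx i j.

Definition GL_subgroup S : Prop :=
  [/\ S `<=` GL,
      S 1%:M,
      forall P Q, S P -> S Q -> S (P *m Q)
    & forall P Q, S P -> P *m Q = 1%:M -> Q *m P = 1%:M -> S Q].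

Definition GE : set 'M[A]_n :=
  smallest GL_subgroup
    [set P | elementary_mx P \/ (GL P /\ is_diag_mx P)].

End GeneralLinear.

Arguments GL A n _ : clear implicits.
Arguments GE A n _ : clear implicits.

Section Hyperbolic.
Variables (R : realType) (X : metricType R).
Implicit Types (p q r s : X) (c : R -> X).

Definition gromov p q r : R := (mdist p r + mdist q r - mdist p q) / 2.

(* Only the restriction of c to [0, |p - q|] matters. *)
Definition geodesic p q c : Prop :=
  [/\ c 0 = p,
      c (mdist p q) = q
    & {in `[0, mdist p q] &, forall t u, mdist (c t) (c u) = `|t - u|}].

Definition hyperbolic (delta : R) : Prop :=
  [/\ 0 <= delta,
      [set: X] !=set0,
      forall p q, exists c, geodesic p q c,
      forall p q r s,
        Num.min (gromov p s r) (gromov s q r) - delta <= gromov p q r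
    & forall p q r c c', geodesic r p c -> geodesic r q c' ->
        forall t : R, 0 <= t <= gromov p q r -> mdist (c t) (c' t) <= delta].

Variable G : groupType.
Implicit Type act : G -> X -> X.

Definition isometric_action act : Prop :=
  [/\ forall p, act 1%g p = p,
      forall g h p, act (g * h)%g p = act g (act h p)
    & forall g p q, mdist (act g p) (act g q) = mdist p q].

(* An infimum in the extended reals: it is +oo when G is trivial. *)
Definition minimal_displacement act : \bar R :=
  ereal_inf [set (mdist (act g p) p)%:E | g in [set g | g != 1%g] & p in [set: X]].

End Hyperbolic.

Definition log2 (R : realType) (x : R) : R := ln x / ln 2.

(* Main.v *)
Require Import Defs.
From mathcomp Require Import all_boot all_order all_algebra finmap.
From mathcomp Require Import monalg.
From mathcomp Require Import all_classical all_reals all_analysis.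
From mathcomp Require Import zify lra.

Set Implicit Arguments.
Unset Strict Implicit.
Unset Printing Implicit Defensive.

Import Order.TTheory GRing.Theory Num.Theory.

Local Open Scope classical_set_scope.
Local Open Scope ring_scope.

(** In the group algebra of a free group, Cohn's weak algorithm shrinks linearly
dependent tuples: if [\sum_i a i * x i = 0] nontrivially, adding to some entry
a left combination of the others makes it smaller.  Large displacement on a
hyperbolic space is enough to run the same algorithm ([reduction_step]).  The
size of [x] is the diameter of its support, where [g] in [G] is placed at the
point [g o] of an orbit; such a support lies in a ball about the midpoint of two
of its farthest points, of radius half the diameter ([circumcentre]).

The relation is a vanishing combination of translates [g * x i], [g] in the
support of [a i].  The height of a point is its distance to [o].  For a height
[t], join two translates when their supports share a point at height at least
[t], let [Q] be a connected component, and let [y] be the part of the relation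
indexed by [Q].  At height [t] and above nothing outside [Q] interferes with
[Q], so there [y] inherits the vanishing of the whole sum: the support of [y]
is below [t].  Suppose that the space is a tree.  The ball around a translate of
radius [r] and centre [c] overhangs [o] by [r - d(c, o)]; a translate with
overhang at most [e] has its centre seen from [o] in the same direction as any
of its points of height at least [t]: the two geodesics agree up to height
[(t - e) / 2].  So, if [e] is the greatest overhang in [Q], all geodesics from
[o] to centres in [Q] coincide up to height [(t - e) / 2], and therefore [y] has
diameter at most [t + e].  A translate in [Q] with overhang [e] that rises well above [t] has a
larger diameter, the sum of its overhang and of the height it reaches.  If it is
the only translate of its entry in [Q], then [y] is, up to a unit, this entry
plus a left combination of the others, and it is smaller.

In a hyperbolic space each step from one translate to a neighbour in [Q] may
lose some of the common part of these geodesics; a path of [2 ^ k] steps loses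
[k].  The displacement bounds the number of steps that matter
([link_path_gromov], [connect_gromov]): translates of much smaller overhang stay
so close together that a whole connected family of them counts as one step, and
two translates of the same entry with overhangs close to [e] that are joined by
a short path have centres so close that they coincide.  Thus [3 * m + 2] steps
are enough for [m] entries.  The height [t] comes from the pigeonhole principle
([thin_component]): among [m + 1] equally spaced heights, two have their
greatest overhang attained at translates of the same entry, which again must
coincide.  In total a displacement of order [m * log m] is used, and it is
available since [(n + 1) ^ (n + 1) <= (n + 1)`! ^ 2].

Iterating the reduction turns any tuple, by row operations, into one whose
nonzero entries are left independent ([exists_reduced]).  For generators of an
ideal these entries are a basis.  The first column of an invertible matrix
becomes a column with a single nonzero entry, which is a unit, and induction on
the size shows that the matrix is a product of elementary and diagonal ones. *)

(** * Gromov products *)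

Section FourPoint.
Variables (R : realType) (X : metricType R).
Hypothesis four_point : forall p q r s : X,
  Num.min (gromov p s r) (gromov s q r) - 1 <= gromov p q r.
Implicit Types (p q r s o u v w : X) (a : R).

Lemma gromov_sym p q r : gromov p q r = gromov q p r.
Proof. by rewrite /gromov (metric_sym p q) (addrC (mdist p r)). Qed.

Lemma gromov_step s p q r a :
  a <= gromov p s r -> a <= gromov s q r -> a - 1 <= gromov p q r.
Proof.
move=> aps asq; apply: le_trans (four_point p q r s).
by rewrite lerD2r le_min aps asq.
Qed.

(** Halving the chain costs one unit of the Gromov product for each doubling of
the number of links, instead of one unit for each link. *)
Lemma gromov_chain o (f : nat -> X) a k N : (0 < N <= 2 ^ k)%N ->
  (forall i, (i < N)%N -> a <= gromov (f i) (f i.+1) o) ->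
  a - k%:R <= gromov (f 0) (f N) o.
Proof.
elim: k N f => [|k IHk] N f /andP[N0 Nk] link.
  have -> : N = 1%N by rewrite expn0 in Nk; lia.
  by rewrite subr0 link.
have [N1|N1] := leqP N 1.
  have -> : N = 1%N by lia.
  apply: le_trans (link 0%N N0).
  by rewrite lerBlDr lerDl.
pose h := N./2.
have hN : (0 < h < N)%N by rewrite /h; lia.
have hk : (h <= 2 ^ k)%N by rewrite expnS in Nk; rewrite /h; lia.
have h'k : (N - h <= 2 ^ k)%N by rewrite expnS in Nk; rewrite /h; lia.
rewrite -natr1 opprD addrA; apply: (@gromov_step (f h)).
  by apply: IHk => [|i ih]; [lia|apply: link; lia].
have := IHk (N - h)%N (fun i => f (h + i)%N).
rewrite addn0 subnKC; last lia.
apply; first lia.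
by move=> i iN; rewrite addnS; apply: link; lia.
Qed.

Lemma four_point_mdist p q r s :
  mdist p q + mdist r s <=
  Num.max (mdist p r + mdist q s) (mdist q r + mdist p s) + 2.
Proof.
have := four_point p q r s; rewrite /gromov (metric_sym s r) (metric_sym s q).
by rewrite ?minElt ?maxElt; case: ltP => ?; case: ltP => ?; lra.
Qed.

(** The midpoint of two farthest points of a set serves as a circumcentre: every
point of the set is close to it ... *)
Lemma midpoint_near u v c w (r : R) : mdist u v = 2 * r ->
  mdist u c = r -> mdist v c = r -> mdist w u <= 2 * r -> mdist w v <= 2 * r ->
  mdist w c <= r + 2.
Proof.
move=> uv uc vc wu wv; have := four_point_mdist u v w c.
by rewrite (metric_sym u w) (metric_sym v w) maxElt; case: ltP => ?; lra.
Qed.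

(** ... and, seen from any point [o], the set extends beyond the midpoint by the
full radius, because one of the two farthest points points away from [o]. *)
Lemma midpoint_far u v c o (r : R) : mdist u v = 2 * r ->
  mdist u c = r -> mdist v c = r ->
  mdist c o + r - 2 <= Num.max (mdist u o) (mdist v o).
Proof.
move=> uv uc vc; have := four_point_mdist u v o c.
by rewrite (metric_sym o c) !maxElt; case: ltP => ?; case: ltP => ?; lra.
Qed.

End FourPoint.

(** * Components of translates of finite sets *)

Lemma cut_path (T : Type) (L : T -> T -> Prop) (f : nat -> T) N i j :
  (i < j < N)%N -> (forall l, (l < N)%N -> L (f l) (f l.+1)) ->
  L (f i) (f j.+1) ->
  exists g, [/\ g 0%N = f 0%N, g (N - (j - i))%N = f N
    & forall l, (l < N - (j - i))%N -> L (g l) (g l.+1)].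
Proof.
move=> /andP[ij jN] Lf Lij.
exists (fun l => if (l <= i)%N then f l else f (l + (j - i))%N); split=> //=.
  have /negbTE-> : ~~ (N - (j - i) <= i)%N by lia.
  by congr f; lia.
move=> l lN; have [li|il] := leqP l i; last first.
  by rewrite ifF ?addSn; [apply: Lf; lia|lia].
have [li'|il'] := leqP l.+1 i; first by apply: Lf; lia.
have -> : l = i by lia.
by have -> : (i.+1 + (j - i) = j.+1)%N by lia.
Qed.

(** The translates are indexed by [T]: [S p] is the support of [p], inside the
ball of centre [c p] and radius [rad (idx p)], where [idx p] is the entry of
which [p] is a translate. *)
Section Components.
Variables (R : realType) (X : metricType R).
Hypothesis four_point : forall p q r s : X,
  Num.min (gromov p s r) (gromov s q r) - 1 <= gromov p q r.
Variables (o : X) (T : finType) (V : eqType) (pt : V -> X) (S : T -> seq V).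
Variables (m : nat) (idx : T -> 'I_m) (rad : 'I_m -> R) (c : T -> X).
Implicit Types (p q : T) (t e : R).

Definition height v := mdist (pt v) o.
(** The greatest height of a point of [S p], to within 2. *)
Definition reach p := rad (idx p) + mdist (c p) o.
(** When nonnegative, the radius of a ball about [o] contained in the ball of
[p]. *)
Definition overhang p := rad (idx p) - mdist (c p) o.

Hypothesis S_near : forall p v, v \in S p ->
  mdist (pt v) (c p) <= rad (idx p) + 2.
Hypothesis S_far : forall p, exists2 v, v \in S p & reach p - 2 <= height v.
Variable top : R.
Hypothesis le_top : forall p v, v \in S p -> height v <= top.

Definition share t p q := has (fun v => (v \in S q) && (t <= height v)) (S p).
Definition share_below t e p q :=
  [&& share t p q, overhang p <= e & overhang q <= e].

Lemma shareP t p q :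
  reflect (exists v, [/\ v \in S p, v \in S q & t <= height v]) (share t p q).
Proof.
apply: (iffP hasP) => [[v vp /andP[vq tv]]|[v [vp vq tv]]]; exists v => //.
by rewrite vq.
Qed.

Lemma share_sym t : symmetric (share t).
Proof. by move=> p q; apply/shareP/shareP => -[v [? ? ?]]; exists v. Qed.

Lemma share_refl t p q : share t p q -> share t p p.
Proof. by case/shareP => v [? ? ?]; apply/shareP; exists v. Qed.

Lemma share_le t t' p q : t <= t' -> share t' p q -> share t p q.
Proof.
by move=> tt' /shareP[v [? ? t'v]]; apply/shareP; exists v; split=> //; lra.
Qed.

Lemma reach_le p : reach p <= top + 2.
Proof. by have [v vp] := S_far p; have := le_top vp; lra. Qed.

(** A point of [S p] at height [t] is seen from [o] in the direction of [c p]: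
in a tree, the two geodesics from [o] agree up to height
[(t - overhang p) / 2]. *)
Lemma center_gromov p v :
  v \in S p -> (height v - overhang p) / 2 - 1 <= gromov (c p) (pt v) o.
Proof.
by move=> /S_near; rewrite /gromov /overhang /height (metric_sym (c p) (pt v)); lra.
Qed.

Lemma share_gromov t e p q :
  overhang p <= e -> overhang q <= e -> share t p q ->
  (t - e) / 2 - 2 <= gromov (c p) (c q) o.
Proof.
move=> pe qe /shareP[v [/center_gromov vp /center_gromov vq tv]].
have -> : (t - e) / 2 - 2 = (t - e) / 2 - 1 - 1 by lra.
apply: (gromov_step four_point (s := pt v)); first lra.
by rewrite (gromov_sym (pt v)); lra.
Qed.

(** Two balls of the same radius whose centres lie in nearly the same direction
have nearly the same centre, since [reach] bounds how much farther one centre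
may be than the other. *)
Lemma same_index_close p q t e a : idx p = idx q ->
  (t - e) / 2 - a <= gromov (c p) (c q) o ->
  mdist (c p) (c q) <= top + 2 - t + (e - overhang p) + 2 * a.
Proof.
by move=> pq; have := reach_le q; rewrite /gromov /reach /overhang pq; lra.
Qed.

(** Paths of [3 * m + 2] links are short enough for [gromov_chain] with loss
[k]. *)
Variable k : nat.
Hypothesis size_k : (3 * m + 2 <= 2 ^ k)%N.
Let slack : R := 2 + k%:R.

Section Level.
Variable t : R.
Hypothesis sep : forall p q, idx p = idx q -> p != q ->
  top - t + 4 * slack + 2 <= mdist (c p) (c q).

(** A step between translates of overhang at most [e] is either a shared point
above [t], or a whole path of translates whose overhang is so small that the
loss along it is invisible at the scale of [e]. *)
Let link e p q := [/\ overhang p <= e, overhang q <= e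
  & share t p q \/ [/\ share t p p, overhang p <= e - 2 * slack
                    & connect (share_below t (e - 2 * slack)) p q]].

(** Long paths of links can be shortened.  Divide the first [3 * m + 3]
translates into [m + 1] consecutive triples.  Either all three members of some
triple have small overhang, and the two links between them merge into one; or
each triple contains a translate of large overhang, two of these have the same
index, they are close by [gromov_chain], hence equal by [sep], and the loop
between them is cut. *)
Lemma link_path_gromov e (f : nat -> T) N :
  (forall p q, link e p q -> (t - e) / 2 - 2 <= gromov (c p) (c q) o) ->
  (0 < N)%N -> (forall l, (l < N)%N -> link e (f l) (f l.+1)) ->
  (t - e) / 2 - slack <= gromov (c (f 0)) (c (f N)) o.
Proof.
move=> link_gromov.
have chain (g : nat -> T) n : (0 < n <= 2 ^ k)%N ->
    (forall l, (l < n)%N -> link e (g l) (g l.+1)) ->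
    (t - e) / 2 - slack <= gromov (c (g 0%N)) (c (g n)) o.
  move=> nk Lg; suff : (t - e) / 2 - 2 - k%:R <= gromov (c (g 0%N)) (c (g n)) o.
    by rewrite /slack; lra.
  apply: (gromov_chain four_point (f := c \o g) nk) => l ln.
  exact/link_gromov/Lg.
have [n leN] := ubnP N; elim: n N leN f => // n IHn N leN f N0 Lf.
have [Nk|kN] := leqP N (2 ^ k); first by apply: chain; rewrite ?N0.
suff [i [j [/andP[ij jN] Lij]]] :
    exists i j, (i < j < N)%N /\ link e (f i) (f j.+1).
  have [|g [<- <- Lg]] := cut_path _ Lf Lij; first by rewrite ij.
  by apply: IHn => //; lia.
have [[b [bm [fb0 fb1 fb2]]]|nb] := pselect (exists b, (b <= m)%N /\
    [/\ overhang (f (3 * b)%N) <= e - 2 * slack,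
        overhang (f (3 * b).+1) <= e - 2 * slack &
        overhang (f (3 * b).+2) <= e - 2 * slack]).
  exists (3 * b)%N, (3 * b).+1; split; first lia.
  have [e0 _ L01] : link e (f (3 * b)%N) (f (3 * b).+1) by apply: Lf; lia.
  have [_ e2 L12] : link e (f (3 * b).+1) (f (3 * b).+2) by apply: Lf; lia.
  split=> //; right; split=> //.
    by case: L01 => [/share_refl//|[]].
  apply: (connect_trans (y := f (3 * b).+1)).
    by case: L01 => [L|[]//]; apply: connect1; rewrite /share_below L fb0 fb1.
  by case: L12 => [L|[]//]; apply: connect1; rewrite /share_below L fb2 fb1.
have big (b : 'I_m.+1) : exists i : nat, (3 * b <= i < 3 * b.+1)%N /\
    e - 2 * slack < overhang (f i).
  apply: contrapT => nbi; apply: nb; exists b; split; first by rewrite -ltnS ltn_ord.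
  by split; rewrite leNgt; apply/negP => bi; apply: nbi;
    eexists; (split; last exact: bi); lia.
have [pos posP] := choice big.
have /injectivePn[b [b' bb' idbb']] :
    ~~ injectiveb (fun b => idx (f (pos b))).
  apply/negP => /injectiveP/leq_card; rewrite !card_ord; lia.
wlog ltbb' : b b' bb' idbb' / (b < b')%N.
  move=> W; case: (ltngtP b b') => [|b'b|/val_inj/eqP]; first exact: W.
    by apply: (W b' b) => //; rewrite eq_sym.
  by rewrite (negbTE bb').
have [/andP[_ posb] _] := posP b; have [/andP[bpos _] _] := posP b'.
have [/andP[_ posb'] _] := posP b'; have b'm := ltn_ord b'.
have ij : (pos b < pos b')%N by lia.
exists (pos b), (pos b'); split; first lia.
suff -> : f (pos b) = f (pos b') by apply: Lf; lia.
apply/eqP; apply: contraT => /(sep idbb').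
have : (t - e) / 2 - slack <= gromov (c (f (pos b))) (c (f (pos b'))) o.
  have := chain (fun l => f (pos b + l)%N) (pos b' - pos b)%N.
  rewrite /= addn0 subnKC; last by lia.
  apply; first by lia.
  by move=> l lb; rewrite addnS; apply: Lf; lia.
move/(same_index_close idbb').
by have [_ +] := posP b; rewrite /slack; lra.
Qed.

(** The loss does not depend on the length of the path.  The induction is on
[e]: connected families of overhang at most [e - 2 * slack] lose
[slack], which the gap of [2 * slack] between the overhangs compensates, so they
count as single links. *)
Lemma connect_gromov e p q : overhang p <= e -> share t p p ->
  connect (share_below t e) p q -> (t - e) / 2 - slack <= gromov (c p) (c q) o.
Proof.
have k0 : 0 <= k%:R :> R by [].
pose base := - \sum_p `|overhang p|.
have base_le r : base <= overhang r.
  rewrite /base (bigD1 r) //= opprD.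
  have : 0 <= \sum_(i | i != r) `|overhang i| by apply: sumr_ge0.
  by have := ler_norm (- overhang r); rewrite normrN; lra.
have [N] : exists N : nat, e < base + N%:R.
  exists (Num.truncn `|e - base|).+1; have := truncnS_gt `|e - base|.
  by have := ler_norm (e - base); lra.
elim: N e p q => [|N IHN] e p q eN pe pp.
  by have := base_le p; lra.
have link_gromov p' q' : link e p' q' ->
    (t - e) / 2 - 2 <= gromov (c p') (c q') o.
  case=> p'e q'e [|[p'p' p'e2 con]]; first exact: share_gromov.
  suff : (t - (e - 2 * slack)) / 2 - slack <= gromov (c p') (c q') o by lra.
  by apply: IHN => //; move: eN; rewrite -natr1 /slack; lra.
have [<- _|pq /connectP[s sp lasts]] := eqVneq p q.
  by apply: (link_path_gromov (f := fun=> p) (N := 1)) => // l _; split=> //; left.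
have -> : q = nth p (p :: s) (size s) by rewrite nth_last lasts.
apply: (link_path_gromov (f := nth p (p :: s)) (N := size s)) => //.
  by case: s sp lasts => //= _ /eqP; rewrite eq_sym (negbTE pq).
by move=> l ls; have /and3P[] := pathP p sp l ls; split=> //; left.
Qed.
End Level.

Lemma connect_share_below t e p q :
  (forall r, connect (share t) p r -> overhang r <= e) ->
  connect (share t) p q -> connect (share_below t e) p q.
Proof.
move=> + /connectP[s + ->]; elim: s p => [|r s IHs] p //= le_e /andP[pr rs].
have pr1 := connect1 pr; apply: (connect_trans (y := r)).
  by apply: connect1; rewrite /share_below pr !le_e.
by apply: IHs => // r' rr'; apply/le_e/(connect_trans pr1).
Qed.

Lemma connect_share_refl t p q :
  share t p p -> connect (share t) p q -> share t q q.
Proof.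
move=> pp /connectP[s sp ->]; case/lastP: s sp => //= s r.
by rewrite last_rcons rcons_path share_sym => /andP[_ /share_refl].
Qed.

(** The diameter bound in [thin_component] exceeds the sum of the cut-off height
and the greatest overhang by [2 * slack + 4]; the remaining 3 pay for the error
of 2 in [reach] and for a gain of 1. *)
Let step := 2 * slack + 7.
Hypothesis sep : forall p q, idx p = idx q -> p != q ->
  m%:R * step + 4 * slack + 2 <= mdist (c p) (c q).

(** Cut the configuration at the heights [level 0 > ... > level m] and follow the
component of the highest translate, which grows as the height decreases.  The
translates of greatest overhang [best 0], ..., [best m] cannot all have distinct
indices; if those at levels [i < j] have the same one, they coincide, since
inside a component an index that attains the greatest overhang occurs once.
Then [best j] is already present at [level i], so it rises a full [step] above
[level j], where it still has the greatest overhang. *)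
Lemma thin_component p0 v0 : v0 \in S p0 -> height v0 = top ->
  exists t (Q : pred T) p1,
  [/\ Q p1,
      forall p q, Q p -> share t p q -> Q q,
      forall p, Q p -> idx p = idx p1 -> p = p1
    & forall p q v w, Q p -> Q q -> v \in S p -> w \in S q ->
        height v < t -> height w < t ->
        mdist (pt v) (pt w) <= 2 * rad (idx p1) - 1].
Proof.
move=> v0p0 v0top; have k0 : 0 <= k%:R :> R by [].
pose level j := top - j%:R * step.
pose Q j := connect (share (level j)) p0.
have level_le i j : (i <= j)%N -> level j <= level i.
  by move=> ij; rewrite lerD2l lerN2 ler_wpM2r ?ler_nat // /step /slack; lra.
have share0 j : share (level j) p0 p0.
  apply/shareP; exists v0; split=> //; rewrite v0top.
  by have := level_le 0%N j (leq0n j); rewrite /level mul0r; lra.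
have QS i j p : (i <= j)%N -> Q i p -> Q j p.
  move=> /level_le ij; apply: connect_sub => p' q'.
  by move/(share_le ij)/connect1.
have /choice[best bestP] : forall j, exists p,
    Q j p /\ forall q, Q j q -> overhang q <= overhang p.
  move=> j; case: (arg_maxP overhang (connect0 _ p0 : Q j p0)) => p Qp pmax.
  by exists p.
have thin j p q : (j <= m)%N -> Q j p -> Q j q ->
    (level j - overhang (best j)) / 2 - slack <= gromov (c p) (c q) o.
  move=> /level_le jm Qp Qq; have [_ le_best] := bestP j.
  apply: connect_gromov; first 1 last.
  - exact: le_best.
  - exact: connect_share_refl Qp.
  - apply: connect_share_below => [r pr|].
      exact/le_best/(connect_trans Qp).
    by apply: connect_trans Qq; rewrite (sym_connect_sym (@share_sym _)).
  move=> p' q' pq' /(sep pq'); move: jm; rewrite /level; lra.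
have uniq j p : (j <= m)%N -> Q j p -> idx p = idx (best j) -> p = best j.
  move=> jm Qp pb; have [Qb _] := bestP j.
  apply/eqP; apply: contraT; rewrite eq_sym => bp.
  have := sep (esym pb) bp.
  have := same_index_close (esym pb) (thin _ _ _ jm Qb Qp).
  by have := level_le _ _ jm; rewrite /level /slack; lra.
have /injectivePn[i [j ij bij]] :
    ~~ injectiveb (fun j : 'I_m.+1 => idx (best j)).
  by apply/negP => /injectiveP/leq_card; rewrite !card_ord; lia.
wlog ltij : i j ij bij / (i < j)%N.
  move=> W; case: (ltngtP i j) => [|ji|/val_inj/eqP]; first exact: W.
    by apply: (W j i) => //; rewrite eq_sym.
  by rewrite (negbTE ij).
have jm : (j <= m)%N by rewrite -ltnS ltn_ord.
have [Qi _] := bestP i; have [Qj le_best] := bestP j.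
have bestE : best i = best j by apply: uniq => //; apply: QS Qi; exact: ltnW.
exists (level j), (Q j), (best j); split=> //.
- by move=> p q Qp pq; apply: connect_trans Qp (connect1 pq).
- by move=> p; apply: uniq.
move=> p q v w Qp Qq vp wq vt wt.
have rad_big : level i - 2 <= reach (best j).
  have /shareP[u [ub _ iu]] := connect_share_refl (share0 i) Qi.
  rewrite bestE in ub; have := S_near ub.
  have := metric_triangle (pt u) (c (best j)) o.
  by rewrite -/(height u) /reach; lra.
have step_ij : level j + step <= level i.
  have : level i - level j = (j - i)%:R * step.
    by rewrite /level natrB 1?ltnW //; lra.
  suff : step <= (j - i)%:R * step by lra.
  by rewrite ler_peMl ?ler1n ?subn_gt0 // /step /slack; lra.
pose e := overhang (best j).
have pe : overhang p <= e by exact: le_best.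
have qe : overhang q <= e by exact: le_best.
have vw : Num.min (height v) (height w) / 2 - e / 2 - slack - 2 <=
    gromov (pt v) (pt w) o.
  set a := Num.min _ _.
  have av : a <= height v by rewrite ge_min lexx.
  have aw : a <= height w by rewrite ge_min lexx orbT.
  have -> : a / 2 - e / 2 - slack - 2 = a / 2 - e / 2 - slack - 1 - 1 by lra.
  apply: (gromov_step four_point (s := c p)).
    rewrite gromov_sym; apply: le_trans (center_gromov vp).
    by rewrite /slack; lra.
  apply: (gromov_step four_point (s := c q)).
    apply: le_trans (thin _ _ _ jm Qp Qq).
    by rewrite -/e; lra.
  apply: le_trans (center_gromov wq).
  by rewrite /slack; lra.
move: vw rad_big step_ij; rewrite minElt /gromov /reach /e /overhang /height /step.
case: ltP => _; move: vt wt; rewrite /height; lra.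
Qed.
End Components.

(** * Shrinking a dependent tuple *)

Lemma seq_argmax (R : realType) (T : eqType) (f : T -> R) (s : seq T) x0 :
  x0 \in s -> exists2 x, x \in s & forall y, y \in s -> f y <= f x.
Proof.
elim: s x0 => // a [|b s] IHs x0 _.
  by exists a; rewrite ?mem_head // => y; rewrite inE => /eqP->.
have [x xs xmax] := IHs b (mem_head _ _).
have [ax|xa] := leP (f a) (f x).
  exists x; first by rewrite inE xs orbT.
  by move=> y; rewrite inE => /predU1P[->|/xmax].
exists a; first exact: mem_head.
move=> y; rewrite inE => /predU1P[->//|/xmax yx].
exact: le_trans yx (ltW xa).
Qed.

Section Coefficients.
Variables (K : fieldType) (G : groupType).
Local Notation A := (group_algebra K G).
Implicit Types (a x : A) (g h w : G).

Lemma galg_coef a x (D : {fset G}) w : (msupp a `<=` D)%fset ->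
  (a * x)@_w = \sum_(g <- D) a@_g * x@_(g^-1 * w)%g.
Proof.
move=> aD; have -> : a * x = galg_mul a x by [].
rewrite (galg_mulw aD (fsubset_refl _)) raddf_sum; apply: eq_bigr => g _.
set h0 := (g^-1 * w)%g; rewrite raddf_sum /=.
have term h : << a@_g * x@_h *g (g * h)%g >>@_w = (a@_g * x@_h) *+ (h == h0).
  rewrite mcoeffU; congr (_ *+ nat_of_bool _).
  by rewrite /h0; apply/eqP/eqP => [<-|->]; rewrite ?mulKg ?mulVKg.
under eq_bigr => h _ do rewrite term.
have [h0x|h0x] := boolP (h0 \in msupp x); last first.
  rewrite [x@_h0]mcoeff_outdom // mulr0 big1_fset // => h hx _.
  by case: eqP => // hh0; rewrite hh0 (negbTE h0x) in hx.
rewrite (big_fsetD1 h0) //= eqxx big1_fset ?addr0 // => h.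
by rewrite !inE => /andP[/negbTE-> _] _.
Qed.

Lemma galg_coef_monomial (k : K) g x w :
  ((<< k *g g >> : A) * x)@_w = k * x@_(g^-1 * w)%g.
Proof. by rewrite (galg_coef _ _ msuppU_le) big_seq_fset1 mcoeffUU. Qed.

Lemma monomial_inv (k : K) g : k != 0 ->
  (<< k^-1 *g g^-1%g >> : A) * << k *g g >> = 1.
Proof.
move=> k0; have -> : (1 : A) = galg_one K G by [].
by rewrite [LHS]galg_mulUU mulVf // mulVg.
Qed.

End Coefficients.

Section Reduction.
Variables (K : fieldType) (G : groupType).
Local Notation A := (group_algebra K G).
Variables (R : realType) (X : metricType R).
Hypothesis hypX : hyperbolic X 1.
Variables (act : G -> X -> X) (o : X).
Hypothesis actX : isometric_action act.
Implicit Types (a x y : A) (g h v w : G).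

Let dist g h := mdist (act g o) (act h o).

Let distMl g v w : dist (g * v)%g (g * w)%g = dist v w.
Proof. by case: actX => _ actM act_iso; rewrite /dist !actM act_iso. Qed.

(** One more than the diameter of the support for [x != 0], and 0 for [x = 0];
so a nonzero element that becomes zero also loses at least 1. *)
Definition spread x : R :=
  \big[Num.max/0]_(v <- msupp x) \big[Num.max/0]_(w <- msupp x) (dist v w + 1).

Lemma spread_ge0 x : 0 <= spread x.
Proof.
rewrite /spread; elim/big_ind: _ => // [r s r0 s0|v _]; first by rewrite le_max r0.
elim/big_ind: _ => // [r s r0 s0|w _]; first by rewrite le_max r0.
by rewrite addr_ge0 // mdist_ge0.
Qed.

Lemma dist_spread x v w : v \in msupp x -> w \in msupp x ->
  dist v w + 1 <= spread x.
Proof.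
move=> vx wx; pose F v := \big[Num.max/0]_(w <- msupp x) (dist v w + 1).
apply: (le_trans _ (le_bigmax_seq 0 v xpredT F vx isT)).
exact: (le_bigmax_seq 0 w xpredT (fun w => dist v w + 1) wx isT).
Qed.

Lemma spread_le x r : 0 <= r ->
  (forall v w, v \in msupp x -> w \in msupp x -> dist v w + 1 <= r) ->
  spread x <= r.
Proof.
move=> r0 xr; rewrite /spread big_seq; apply: bigmax_le => // v vx.
by rewrite big_seq; apply: bigmax_le => // w wx; apply: xr.
Qed.

Lemma msupp_neq0 x : x != 0 -> exists v, v \in msupp x.
Proof.
move=> /eqP x0; apply: contrapT => nx; apply: x0; apply/malgP => v.
by rewrite mcoeff0 mcoeff_outdom //; apply/negP => vx; apply: nx; exists v.
Qed.

Lemma spread_attained x : x != 0 ->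
  exists v w, [/\ v \in msupp x, w \in msupp x & dist v w + 1 = spread x].
Proof.
move=> /msupp_neq0[v0 v0x].
have /seq_argmax : (v0, v0) \in [seq (v, w) | v <- msupp x, w <- msupp x].
  exact: allpairs_f.
move=> /(_ _ (fun p => dist p.1 p.2)) [_ /allpairsP[[v w] /= [vx wx ->]]] le_vw.
exists v, w; split=> //; apply/eqP; rewrite eq_le dist_spread //=.
apply: spread_le => [|v' w' v'x w'x]; first by rewrite addr_ge0 // mdist_ge0.
by rewrite lerD2r (le_vw (v', w')) //; apply: allpairs_f.
Qed.

Let geo (p q : X) : exists c, geodesic p q c.
Proof. by case: hypX. Qed.

Let four_point (p q r s : X) :
  Num.min (gromov p s r) (gromov s q r) - 1 <= gromov p q r.
Proof. by case: hypX. Qed.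

Lemma circumcentre x : exists c : X, x != 0 ->
  (forall v, v \in msupp x -> mdist (act v o) c <= (spread x - 1) / 2 + 2) /\
  (forall u, exists2 v, v \in msupp x
    & (spread x - 1) / 2 + mdist c u - 2 <= mdist (act v o) u).
Proof.
have [->|x0] := eqVneq x 0; first by exists o.
have [v [w [vx wx vw]]] := spread_attained x0.
set r := (spread x - 1) / 2.
have vwE : mdist (act v o) (act w o) = 2 * r by rewrite /r -vw /dist; lra.
have r0 : 0 <= r by have := mdist_ge0 (act v o) (act w o); lra.
have [c [c0 c1 c_iso]] := geo (act v o) (act w o); rewrite vwE in c1 c_iso.
have c_dist t u : 0 <= t <= 2 * r -> 0 <= u <= 2 * r ->
    mdist (c t) (c u) = `|t - u|.
  by move=> ? ?; apply: c_iso; rewrite in_itv.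
have vc : mdist (act v o) (c r) = r.
  by rewrite -c0 c_dist ?sub0r ?normrN ?ger0_norm //; lra.
have wc : mdist (act w o) (c r) = r.
  by rewrite -c1 c_dist ?ger0_norm //; lra.
exists (c r) => _; split=> [u ux|u].
  have uv := dist_spread ux vx; have uw := dist_spread ux wx.
  by apply: (midpoint_near four_point vwE vc wc); rewrite /r; move: uv uw; rewrite /dist; lra.
have := midpoint_far four_point u vwE vc wc.
by rewrite le_max => /orP[] far; [exists v|exists w] => //; move: far; lra.
Qed.

Variables (m k : nat).
Hypothesis size_k : (3 * m + 2 <= 2 ^ k)%N.
Hypothesis displacement : forall g p, g != 1%g ->
  m%:R * (2 * (2 + k%:R) + 7) + 4 * (2 + k%:R) + 2 <= mdist (act g p) p.

(** The part of the relation carried by the component of [thin_component] has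
its support below the cutting height, because a translate that meets it higher
up belongs to the component.  It contains exactly one translate of the entry
[i1], whose coefficient is a unit, and it is smaller than that entry. *)
Lemma reduction_step (a x : 'I_m -> A) i0 :
  \sum_i a i * x i = 0 -> a i0 != 0 -> x i0 != 0 ->
  exists i1 (b : 'I_m -> A),
    spread (x i1 + \sum_(j | j != i1) b j * x j) <= spread (x i1) - 1.
Proof.
move=> rel a0 x0; have [act1 actM act_iso] := actX.
have /choice[cen cenP] i := circumcentre (x i).
(* The translates of the relation form a finite type once the group elements
   are taken in the union of the supports of the coefficients. *)
pose D := (\bigcup_(i <- enum 'I_m) msupp (a i))%fset.
have aD i : (msupp (a i) `<=` D)%fset by apply: bigfcup_sup; rewrite ?mem_enum.
pose T := {p : 'I_m * D | ((a p.1)@_(val p.2) != 0) && (x p.1 != 0)}.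
pose idx (p : T) := (val p).1; pose elt (p : T) := val (val p).2.
have elt_a p : (a (idx p))@_(elt p) != 0 by case/andP: (valP p).
have idx_x p : x (idx p) != 0 by case/andP: (valP p).
have mkT i g : (a i)@_g != 0 -> x i != 0 -> exists p : T, idx p = i /\ elt p = g.
  move=> aig xi; have gD : g \in D.
    by apply: (fsubsetP (aD i)); rewrite -mcoeff_neq0.
  pose ig : 'I_m * D := (i, FSetSub gD).
  have igP : ((a ig.1)@_(val ig.2) != 0) && (x ig.1 != 0) by rewrite aig xi.
  by exists (exist _ ig igP).
have T_inj p q : idx p = idx q -> elt p = elt q -> p = q.
  by move=> pq /val_inj pq'; apply: val_inj; exact: injective_projections.
pose S (p : T) := [seq (elt p * v)%g | v <- msupp (x (idx p))].
have SP p w : (w \in S p) = ((x (idx p))@_((elt p)^-1 * w)%g != 0).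
  rewrite mcoeff_neq0; apply/mapP/idP => [[v vx ->]|]; first by rewrite mulKg.
  by exists ((elt p)^-1 * w)%g; rewrite ?mulVKg.
have [p00 [_ _]] : exists p : T, idx p = i0 /\ True.
  have [g] := msupp_neq0 a0; rewrite -mcoeff_neq0 => /mkT/(_ x0)[p [pi _]].
  by exists p.
have [p0 [v0 [v0p0 v0_max]]] : exists (p0 : T) v0, v0 \in S p0 /\
    forall (p : T) v, v \in S p -> mdist (act v o) o <= mdist (act v0 o) o.
  have [u] := msupp_neq0 (idx_x p00); rewrite -mcoeff_neq0 => u0.
  have pts_in (p : T) v : v \in S p -> v \in flatten [seq S p | p : T].
    by move=> vp; apply/flattenP; exists (S p) => //; apply: map_f; rewrite mem_enum.
  have : (elt p00 * u)%g \in S p00 by rewrite SP mulKg.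
  move=> /pts_in/(seq_argmax (fun v => mdist (act v o) o))[v0 + v0_max].
  by move=> /flatten_imageP[p _ v0p]; exists p, v0; split=> // q v /pts_in/v0_max.
pose rad i := (spread (x i) - 1) / 2.
pose c (p : T) := act (elt p) (cen (idx p)).
have pt_act g v q : mdist (act v o) (act g q) = mdist (act (g^-1 * v)%g o) q.
  by rewrite -[RHS](act_iso g) -actM mulVKg.
have S_near (p : T) v : v \in S p -> mdist (act v o) (c p) <= rad (idx p) + 2.
  rewrite SP mcoeff_neq0 pt_act => vp.
  by have [+ _] := cenP _ (idx_x p); apply.
have S_far (p : T) : exists2 v, v \in S p &
    rad (idx p) + mdist (c p) o - 2 <= mdist (act v o) o.
  have [_ /(_ (act (elt p)^-1%g o))[v vx far]] := cenP _ (idx_x p).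
  exists (elt p * v)%g; first by rewrite SP mulKg mcoeff_neq0.
  have act_inv q : mdist q (act (elt p)^-1%g o) = mdist (act (elt p) q) o.
    by rewrite -(act_iso (elt p)) -[in LHS]actM mulgV act1.
  by move: far; rewrite !act_inv -actM.
have sep (p q : T) : idx p = idx q -> p != q ->
    m%:R * (2 * (2 + k%:R) + 7) + 4 * (2 + k%:R) + 2 <= mdist (c p) (c q).
  move=> pq npq; rewrite metric_sym /c pq -(act_iso (elt p)^-1%g) -!actM.
  rewrite mulVg act1; apply: displacement; apply/eqP => eltpq.
  move/eqP: npq; apply; apply: T_inj => //.
  by rewrite -[LHS]mulg1 -eltpq mulVKg.
have [t [Q [p1 [Qp1 Q_closed Q_uniq Q_small]]]] :=
  thin_component four_point S_near S_far v0_max size_k sep v0p0 erefl.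
(* [b] is the part of [a] selected by the component. *)
pose sel i g := [exists p : T, [&& Q p, idx p == i & elt p == g]].
have selP (p : T) : Q p -> sel (idx p) (elt p).
  by move=> Qp; apply/existsP; exists p; rewrite Qp !eqxx.
pose b i : A := [malg g in msupp (a i) => if sel i g then (a i)@_g else 0].
have bE i g : (b i)@_g = if sel i g then (a i)@_g else 0.
  by rewrite /b mcoeffE; case: ifPn => // /mcoeff_outdom->; rewrite if_same.
have bD i : (msupp (b i) `<=` D)%fset.
  apply: fsubset_trans (aD i); apply/fsubsetP => g.
  by rewrite -!mcoeff_neq0 bE; case: ifP; rewrite ?eqxx.
pose y := \sum_i b i * x i.
have sumE (f : 'I_m -> A) w : (forall i, msupp (f i) `<=` D)%fset ->
    (\sum_i f i * x i)@_w = \sum_i \sum_(g <- D) (f i)@_g * (x i)@_(g^-1 * w)%g.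
  by move=> fD; rewrite raddf_sum; apply: eq_bigr => i _; rewrite /= (galg_coef _ _ (fD i)).
have y_supp w : w \in msupp y ->
    mdist (act w o) o < t /\ exists2 p : T, Q p & w \in S p.
  rewrite -mcoeff_neq0 => yw.
  have [p Qp wp] : exists2 p : T, Q p & w \in S p.
    apply: contrapT => np; move/eqP: yw; apply; rewrite sumE //.
    rewrite big1 // => i _; rewrite big1 // => g _; rewrite bE.
    case: ifPn => [/existsP[p /and3P[Qp /eqP<- /eqP<-]]|_]; last by rewrite mul0r.
    have [->|xw] := eqVneq ((x (idx p))@_((elt p)^-1 * w)%g) 0; first by rewrite mulr0.
    by case: np; exists p; rewrite ?SP.
  split; last by exists p.
  rewrite ltNge; apply/negP => tw; move/eqP: yw; apply.
  rewrite -(mcoeff0 w) -rel !sumE //; apply: eq_bigr => i _; apply: eq_bigr => g _.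
  rewrite bE; case: ifPn => // nsel.
  have [->|xw] := eqVneq ((x i)@_(g^-1 * w)%g) 0; first by rewrite !mulr0.
  have [->|aig] := eqVneq ((a i)@_g) 0; first by rewrite !mul0r.
  have xi : x i != 0 by apply: contraNneq xw => ->; rewrite mcoeff0.
  have [q [qi qg]] := mkT i g aig xi.
  case/negP: nsel; rewrite -qi -qg; apply/selP/(Q_closed p) => //.
  by apply/shareP; exists w; split=> //; rewrite SP qi qg.
(* By uniqueness of the index, a single monomial is selected for it. *)
have b1 : b (idx p1) = << (a (idx p1))@_(elt p1) *g elt p1 >>.
  apply/malgP => g; rewrite bE mcoeffU; have [<-|np] := eqVneq (elt p1) g.
    by rewrite selP.
  rewrite ifF //; apply/existsP => -[p /and3P[Qp /eqP pi /eqP pg]].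
  by case/eqP: np; rewrite -pg (Q_uniq p).
pose u : A := << ((a (idx p1))@_(elt p1))^-1 *g (elt p1)^-1%g >>.
exists (idx p1), (fun j => u * b j).
have -> : x (idx p1) + \sum_(j | j != idx p1) u * b j * x j = u * y.
  rewrite /y [in RHS](bigD1 (idx p1)) //= mulrDr mulrA b1 monomial_inv // mul1r.
  by congr (_ + _); rewrite mulr_sumr; apply: eq_bigr => j _; rewrite mulrA.
have uy v : v \in msupp (u * y) -> (elt p1 * v)%g \in msupp y.
  rewrite -!mcoeff_neq0 galg_coef_monomial invgK.
  by apply: contraNneq => ->; rewrite mulr0.
have [v [w [vx wx vw]]] := spread_attained (idx_x p1).
apply: spread_le => [|v' w' /uy/y_supp[v't [p Qp v'p]] /uy/y_supp[w't [q Qq w'q]]].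
  by rewrite -vw addrK mdist_ge0.
rewrite -(distMl (elt p1)).
by have := Q_small _ _ _ _ Qp Qq v'p w'q v't w't; rewrite /rad /dist; lra.
Qed.
End Reduction.

(** * Elementary operations and reduced columns *)

Section GeneralLinearGroup.
Variables (A : nzRingType) (m : nat).
Implicit Types (P Q : 'M[A]_m).

Lemma GE_gen P : elementary_mx P \/ (GL A m P /\ is_diag_mx P) -> GE A m P.
Proof. by move=> genP S [_]; apply. Qed.

Lemma GE1 : GE A m 1%:M.
Proof. by move=> S [[]]. Qed.

Lemma GE_mul P Q : GE A m P -> GE A m Q -> GE A m (P *m Q).
Proof.
move=> GP GQ S SS; have [[_ _ SM _] _] := SS.
by apply: SM; [apply: GP|apply: GQ].
Qed.

Lemma GE_inv P Q : GE A m P -> P *m Q = 1%:M -> Q *m P = 1%:M -> GE A m Q.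
Proof.
move=> GP PQ QP S SS; have [[_ _ _ SV] _] := SS.
by apply: SV PQ QP; apply: GP.
Qed.

Lemma delta_mulmxE p (i j : 'I_m) (M : 'M[A]_(m, p)) r l :
  (delta_mx i j *m M) r l = M j l *+ (r == i).
Proof.
rewrite mxE (bigD1 j) //= big1 => [|s sj].
  by rewrite addr0 !mxE eqxx andbT mulr_natl.
by rewrite mxE (negbTE sj) andbF mul0r.
Qed.

Lemma transvectionM (i j : 'I_m) (a b : A) : i != j ->
  (1%:M + a *: delta_mx i j) *m (1%:M + b *: delta_mx i j) =
  1%:M + (a + b) *: delta_mx i j :> 'M[A]_m.
Proof.
move=> ij; rewrite mulmxDl mul1mx mulmxDr mulmx1 -scalemxAl.
suff -> : delta_mx i j *m (b *: delta_mx i j) = 0 :> 'M[A]_m.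
  by rewrite scaler0 addr0 -addrA -scalerDl (addrC b).
apply/matrixP => r l; rewrite delta_mulmxE !mxE (eq_sym j) (negbTE ij).
by rewrite mulr0 mul0rn.
Qed.

Lemma transvection_mulE p (i j : 'I_m) (a : A) (M : 'M[A]_(m, p)) r l :
  ((1%:M + a *: delta_mx i j) *m M) r l = M r l + (a * M j l) *+ (r == i).
Proof.
rewrite mulmxDl mul1mx [LHS]mxE -scalemxAl; congr (_ + _).
by rewrite mxE delta_mulmxE mulrnAr.
Qed.

Lemma GL_mul P Q : GL A m P -> GL A m Q -> GL A m (P *m Q).
Proof.
move=> [P' [PP' P'P]] [Q' [QQ' Q'Q]]; exists (Q' *m P').
by rewrite !mulmxA -(mulmxA P) QQ' mulmx1 -(mulmxA Q') P'P mulmx1.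
Qed.

Lemma GE_sub_GL : GE A m `<=` GL A m.
Proof.
move=> P; apply; split; first split=> //.
- by exists 1%:M; rewrite mulmx1.
- exact: GL_mul.
- by move=> P' Q _ PQ QP; exists P'.
move=> Q [[i [j [a [ij ->]]]]|[]//]; exists (1%:M + (- a) *: delta_mx i j).
by rewrite !transvectionM // subrr addNr scale0r addr0.
Qed.

Definition add_rows (i : 'I_m) (b : 'I_m -> A) : 'M[A]_m :=
  1%:M + \sum_(j | j != i) b j *: delta_mx i j.

(** The rank one updates of [1] in the same row [i], away from the diagonal,
multiply by adding up. *)
Lemma GE_add_rows i b : GE A m (add_rows i b).
Proof.
rewrite /add_rows -big_filter; set s := [seq _ <- _ | _].
have : all (fun j => j != i) s by apply: filter_all.
elim: s => [|j s IHs] /=; first by rewrite big_nil addr0 => _; apply: GE1.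
move=> /andP[ji si]; rewrite big_cons.
set N := \sum_(j <- s) _.
have -> : 1%:M + (b j *: delta_mx i j + N) =
    (1%:M + b j *: delta_mx i j) *m (1%:M + N).
  rewrite mulmxDl mul1mx mulmxDr mulmx1 -!scalemxAl.
  suff -> : delta_mx i j *m N = 0.
    by rewrite scaler0 addr0 -addrA (addrC N).
  apply/matrixP => r l; rewrite delta_mulmxE [RHS]mxE /N summxE big1 ?mul0rn // => q _.
  by rewrite !mxE (negbTE ji) mulr0.
apply: GE_mul (IHs si); apply: GE_gen; left; exists i, j, (b j).
by rewrite eq_sym.
Qed.

Lemma add_rowsE p i b (M : 'M[A]_(m, p)) r l :
  (add_rows i b *m M) r l =
  M r l + (\sum_(j | j != i) b j * M j l) *+ (r == i).
Proof.
rewrite /add_rows mulmxDl mul1mx [LHS]mxE mulmx_suml summxE -sumrMnl.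
congr (_ + _); apply: eq_bigr => j _.
by rewrite -scalemxAl mxE delta_mulmxE mulrnAr.
Qed.

End GeneralLinearGroup.

Section NormalForm.
Variables (A : nzRingType) (R : realType) (mu : A -> R) (m : nat).

(** The nonzero entries of [x] are left linearly independent. *)
Definition reduced (x : 'cV[A]_m) :=
  forall a : 'rV[A]_m, a *m x = 0 -> forall i, a 0 i = 0 \/ x i 0 = 0.

(** A weak form of the division algorithm, for [m] elements. *)
Definition shrinks_dependent := forall (a x : 'I_m -> A) i,
  \sum_i a i * x i = 0 -> a i != 0 -> x i != 0 ->
  exists i1 (b : 'I_m -> A),
    mu (x i1 + \sum_(j | j != i1) b j * x j) <= mu (x i1) - 1.

Hypothesis mu_ge0 : forall x, 0 <= mu x.
Hypothesis reduction : shrinks_dependent.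

(** Each reduction decreases the sum of the sizes of the entries by at least 1,
so finitely many of them lead to a reduced column. *)
Lemma exists_reduced (x : 'cV[A]_m) : exists2 P, GE A m P & reduced (P *m x).
Proof.
have [N] : exists N : nat, \sum_i mu (x i 0) < N%:R.
  exists (Num.truncn (\sum_i mu (x i 0))).+1; exact: truncnS_gt.
elim: N x => [|N IHN] x xN.
  suff : 0 <= \sum_i mu (x i 0) by rewrite leNgt xN.
  by apply: sumr_ge0.
have [red|nred] := pselect (reduced x).
  by exists 1%:M; [exact: GE1|rewrite mul1mx].
have [a ax [i [ai xi]]] : exists2 a : 'rV[A]_m, a *m x = 0 &
    exists i, a 0 i != 0 /\ x i 0 != 0.
  apply: contrapT => na; apply: nred => a ax i.
  have [a0|a0] := eqVneq (a 0 i) 0; first by left.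
  have [x0|x0] := eqVneq (x i 0) 0; first by right.
  by case: na; exists a => //; exists i.
have rel : \sum_i a 0 i * x i 0 = 0.
  by move/matrixP: ax => /(_ 0 0); rewrite !mxE.
have [i1 [b dec]] := reduction rel ai xi.
have [|P GP redP] := IHN (add_rows i1 b *m x).
  rewrite (bigD1 i1) //= add_rowsE eqxx.
  under eq_bigr => i' i'1 do rewrite add_rowsE (negbTE i'1) addr0.
  by move: xN; rewrite (bigD1 i1) //= -natr1; lra.
by exists (P *m add_rows i1 b); rewrite -?mulmxA //; apply: GE_mul (GE_add_rows _ _).
Qed.

End NormalForm.

(** * From reduced columns to products of elementary matrices *)

Section BlockStep.
Variables (A : nzRingType) (m : nat).
Implicit Types (P Q : 'M[A]_m).

Definition pad P : 'M[A]_(1 + m) := block_mx 1%:M 0 0 P.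

Lemma padM P Q : pad P *m pad Q = pad (P *m Q).
Proof.
by rewrite mulmx_block !mul1mx !mul0mx !mulmx0 !addr0 !add0r.
Qed.

Lemma pad1 : pad 1%:M = 1%:M.
Proof. by rewrite /pad -scalar_mx_block. Qed.

Lemma GL_pad P : GL A m P -> GL A (1 + m) (pad P).
Proof. by move=> [Q [PQ QP]]; exists (pad Q); rewrite !padM PQ QP pad1. Qed.

Lemma GE_pad P : GE A m P -> GE A (1 + m) (pad P).
Proof.
move=> GP; suff [] : GL A m P /\ GE A (1 + m) (pad P) by [].
apply: GP (fun P => GL A m P /\ GE A (1 + m) (pad P)) _; split; first split.
- by move=> Q [].
- by split; [exists 1%:M; rewrite mulmx1|rewrite pad1; apply: GE1].
- by move=> Q Q' [? ?] [? ?]; split; [exact: GL_mul|rewrite -padM; exact: GE_mul].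
- move=> Q Q' [_ GQ] QQ' Q'Q; split; first by exists Q.
  by apply: GE_inv GQ _ _; rewrite padM ?QQ' ?Q'Q pad1.
move=> Q [|[GQ diagQ]].
  move=> [i [j [a [ij QE]]]]; split.
    by apply: GE_sub_GL; apply: GE_gen; left; exists i, j, a.
  apply: GE_gen; left; exists (rshift 1 i), (rshift 1 j), a; split.
    by apply: contraNneq ij => /rshift_inj->.
  rewrite QE -pad1; apply/matrixP => r l.
  case: (split_ordP r) => r' ->; case: (split_ordP l) => l' ->.
  - by rewrite [RHS]mxE /pad !block_mxEul !mxE !eq_shift mulr0 addr0.
  - by rewrite [RHS]mxE /pad !block_mxEur !mxE !eq_shift mulr0 addr0.
  - by rewrite [RHS]mxE /pad !block_mxEdl !mxE !eq_shift andbF mulr0 addr0.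
  - by rewrite [RHS]mxE /pad !block_mxEdr !mxE !eq_shift.
split=> //; apply: GE_gen; right; split; first exact: GL_pad.
apply/is_diag_mxP => r l.
case: (split_ordP r) => r' ->; case: (split_ordP l) => l' -> rl.
- by move: rl; rewrite !ord1 eqxx.
- by rewrite /pad block_mxEur mxE.
- by rewrite /pad block_mxEdl mxE.
- rewrite /pad block_mxEdr; apply: (is_diag_mxP diagQ).
  by move: rl; rewrite /= eqn_add2l.
Qed.

Hypothesis domain : forall a b : A, a * b = 0 -> a = 0 \/ b = 0.

Lemma upper_block_GE (v w : A) (b : 'rV[A]_m) P :
  v * w = 1 -> w * v = 1 -> GE A m P ->
  GE A (1 + m) (block_mx v%:M b 0 P).
Proof.
move=> vw wv GP.
have -> : block_mx v%:M b 0 P = block_mx v%:M 0 0 1%:M *m (pad P *m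
    block_mx 1%:M (w *: b) 0 1%:M).
  rewrite /pad !mulmx_block !mul1mx !mul0mx !mulmx0 !mulmx1 !addr0 !add0r.
  by rewrite mulmx1 mul_scalar_mx scalerA vw scale1r.
apply: GE_mul; last apply: GE_mul (GE_pad GP) _.
  apply: GE_gen; right; split.
    exists (block_mx w%:M 0 0 1%:M).
    rewrite !mulmx_block !mul0mx !mulmx0 !mulmx1 !addr0 !add0r -!scalar_mxM.
    by rewrite vw wv -!scalar_mx_block.
  apply/is_diag_mxP => r l.
  case: (split_ordP r) => r' ->; case: (split_ordP l) => l' -> rl.
  - by move: rl; rewrite !ord1 eqxx.
  - by rewrite block_mxEur mxE.
  - by rewrite block_mxEdl mxE.
  - by rewrite block_mxEdr mxE; case: (eqVneq r' l') rl => // ->; rewrite eqxx.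
suff -> : block_mx 1%:M (w *: b) 0 1%:M =
    add_rows (lshift m 0) (fun j => (row_mx 0 (w *: b)) 0 j) by exact: GE_add_rows.
apply/matrixP => r l; rewrite -[add_rows _ _]mulmx1 add_rowsE.
case: (split_ordP l) => l' ->.
  rewrite big1 => [|j jl]; last by rewrite [1%:M _ _]mxE (ord1 l') (negbTE jl) mulr0.
  rewrite mul0rn addr0; case: (split_ordP r) => r' ->.
    by rewrite block_mxEul !mxE eq_shift.
  by rewrite block_mxEdl !mxE eq_shift.
rewrite (bigD1 (rshift 1 l')) ?eq_shift //= row_mxEr [1%:M (rshift 1 l') _]mxE eqxx mulr1.
rewrite big1 => [|j /andP[_ /negbTE jl]]; last by rewrite [1%:M j _]mxE jl mulr0.
case: (split_ordP r) => r' ->; rewrite ?block_mxEur ?block_mxEdr !mxE !eq_shift.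
  by rewrite !ord1 add0r addr0.
by rewrite addr0.
Qed.

Lemma GE_cancel m' (T P : 'M[A]_m') :
  GE A m' T -> GE A m' (T *m P) -> GE A m' P.
Proof.
move=> GT GTP; have [T' [TT' T'T]] := GE_sub_GL GT.
rewrite -[P]mul1mx -T'T -mulmxA; apply: GE_mul GTP.
exact: GE_inv GT TT' T'T.
Qed.

Let i0 : 'I_(1 + m) := lshift m 0.

(** A unit in the corner above a zero column splits off as a diagonal factor and
a unipotent one, and the complementary block stays invertible. *)
Lemma first_column_GE (v w : A) (P : 'M[A]_(1 + m)) :
  GL A m `<=` GE A m -> v * w = 1 -> w * v = 1 -> GL A (1 + m) P ->
  (forall r, P r i0 = v *+ (r == i0)) -> GE A (1 + m) P.
Proof.
move=> IH vw wv [Q [PQ QP]] Pcol.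
have Pul : ulsubmx P = v%:M.
  by apply/matrixP => r l; rewrite !mxE !ord1 Pcol eqxx.
have Pdl : dlsubmx P = 0.
  apply/matrixP => r l; rewrite !mxE (ord1 l) -/i0 Pcol.
  by rewrite /i0 eq_shift mulr0n.
rewrite -[P]submxK Pul Pdl in PQ QP *.
rewrite -[Q]submxK in PQ QP.
rewrite !mulmx_block !mulmx0 !mul0mx !addr0 !add0r in PQ QP.
have [_ _ Qdl PQdr] : [/\ True, True, True & drsubmx P *m drsubmx Q = 1%:M].
  by move: PQ; rewrite scalar_mx_block => /eq_block_mx[].
apply: (upper_block_GE _ vw wv (IH _ _)); exists (drsubmx Q); split=> //.
move: QP; rewrite scalar_mx_block => /eq_block_mx[_ _ Qv <-].
suff -> : dlsubmx Q = 0 by rewrite mul0mx add0r.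
by rewrite -[LHS]mulmx1 -vw scalar_mxM mulmxA Qv mul0mx.
Qed.

(** Let [P] be invertible with inverse [Q] and with reduced first column.  The
rows of [Q] other than the first annihilate that column, so they vanish at every
index [j] where it is nonzero.  Hence column [j] of [Q] has a single nonzero
entry [w], and [P *m Q = 1] gives [P j 0 * w = 1] and [P r 0 * w = 0] for
[r != j]: the first column of [P] has a single nonzero entry, a unit, which two
transvections move to the corner. *)
Lemma GL_sub_GE_step : (forall x : 'cV[A]_(1 + m),
    exists2 P, GE A (1 + m) P & reduced (P *m x)) ->
  GL A m `<=` GE A m -> GL A (1 + m) `<=` GE A (1 + m).
Proof.
move=> normal IH P0 GP0.
have [T GT redT] := normal (col i0 P0).
apply: (GE_cancel GT); have := GL_mul (GE_sub_GL GT) GP0.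
have : col i0 (T *m P0) = T *m col i0 P0 by rewrite !colE mulmxA.
move: (T *m P0) => P PE GP; have [Q [PQ QP]] := GP.
have redP (a : 'rV_(1 + m)) : a *m col i0 P = 0 -> forall i, a 0 i = 0 \/ P i i0 = 0.
  by rewrite PE => /redT + i => /(_ i); rewrite -PE [_ i 0]mxE.
have [j Pj] : exists j, P j i0 != 0.
  apply: contrapT => nj; move/matrixP: QP => /(_ i0 i0).
  rewrite !mxE eqxx big1 => [/esym/eqP|j _]; first by rewrite oner_eq0.
  have [->|Pj] := eqVneq (P j i0) 0; first by rewrite mulr0.
  by case: nj; exists j.
have Q0 i : i != i0 -> Q i j = 0.
  move=> ii0; have QPi : (Q *m P) i i0 = 0 by rewrite QP mxE (negbTE ii0).
  have [|//|/eqP] := redP (row i Q) _ j; last by rewrite (negbTE Pj).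
    apply/matrixP => r l; rewrite [RHS]mxE -QPi !mxE.
    by apply: eq_bigr => s _; rewrite !mxE.
  by rewrite mxE.
pose v := P j i0; pose w := Q i0 j.
have PQj r : P r i0 * w = (r == j)%:R.
  move/matrixP: PQ => /(_ r j); rewrite !mxE (bigD1 i0) //= big1 ?addr0 // => s si.
  by rewrite Q0 ?mulr0.
have vw : v * w = 1 by rewrite PQj eqxx.
have Pcol r : P r i0 = v *+ (r == j).
  have := PQj r; case: (eqVneq r j) => [->//|_] /domain[//|w0].
  by move: vw; rewrite w0 mulr0 => /esym/eqP; rewrite oner_eq0.
have wv : w * v = 1.
  move/matrixP: QP => /(_ i0 i0); rewrite !mxE eqxx (bigD1 j) //= big1 ?addr0 // => s sj.
  by rewrite Pcol (negbTE sj) mulr0.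
have [ji|ji] := eqVneq j i0.
  by apply: (first_column_GE IH vw wv GP) => r; rewrite Pcol ji.
pose E1 : 'M[A]_(1 + m) := 1%:M + 1 *: delta_mx i0 j.
pose E2 : 'M[A]_(1 + m) := 1%:M + (-1) *: delta_mx j i0.
have GE1' : GE A (1 + m) E1 by apply: GE_gen; left; exists i0, j, 1; rewrite eq_sym.
have GE2 : GE A (1 + m) E2 by apply: GE_gen; left; exists j, i0, (-1).
apply: (GE_cancel GE1'); apply: (GE_cancel GE2).
apply: (first_column_GE IH vw wv) => [|r].
  by apply: GL_mul (GE_sub_GL GE2) (GL_mul (GE_sub_GL GE1') GP).
rewrite !transvection_mulE !Pcol eqxx mul1r !eqxx (eq_sym i0 j) (negbTE ji).
rewrite mulr0n add0r mulN1r; have [->|rj] := eqVneq r j.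
  by rewrite (negbTE ji) mulr0n addr0 mulr1n subrr.
by rewrite !mulr0n addr0 add0r.
Qed.
End BlockStep.

(** * Free ideals *)

Section FreeIdeal.
Variables (A : nzRingType) (m : nat).
Implicit Types (x y : 'cV[A]_m).

Definition row_span y : set A^o :=
  [set \sum_i a i *: (y i 0 : A^o) | a in [set: 'I_m -> A]].

Lemma row_spanP y v :
  row_span y v <-> exists a : 'rV[A]_m, v = (a *m y) 0 0.
Proof.
split=> [[a _ <-]|[a ->]].
  by exists (\row_i a i); rewrite mxE; apply: eq_bigr => i _; rewrite mxE.
by exists (a 0) => //; rewrite mxE.
Qed.

Lemma row_span_GL P x : GL A m P -> row_span (P *m x) = row_span x.
Proof.
move=> [Q [_ QP]]; apply/seteqP; split=> v /row_spanP[a ->]; apply/row_spanP.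
  by exists (a *m P); rewrite mulmxA.
by exists (a *m Q); rewrite mulmxA -(mulmxA a) QP mulmx1.
Qed.

Lemma big_fset_eq (z : A^o) (F : {fset A^o}) (f : A^o -> A^o) :
  \sum_(b <- F | z == b) f b = if z \in F then f z else 0.
Proof.
case: ifPn => zF.
  rewrite big_mkcond (big_fsetD1 z) //= eqxx big1_fset ?addr0 // => b.
  by rewrite !inE eq_sym => /andP[/negbTE->].
rewrite big_seq_cond big1 // => b /andP[bF /eqP zb].
by rewrite zb bF in zF.
Qed.

Lemma reduced_inj y i j : reduced y -> y i 0 != 0 -> y i 0 = y j 0 -> i = j.
Proof.
move=> redy yi yij; apply/eqP; apply: contraNT yi => ij; apply/eqP.
pose a : 'rV[A]_m := delta_mx 0 i - delta_mx 0 j.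
have ay : a *m y = 0.
  rewrite mulmxBl -!rowE; apply/matrixP => r l.
  by rewrite !mxE !ord1 yij subrr.
have [|//] := redy _ ay i; rewrite !mxE !eqxx (negbTE ij) subr0 => /eqP.
by rewrite oner_eq0.
Qed.

Lemma reduced_basis y : reduced y ->
  is_basis (row_span y) [set b | b != 0 /\ exists i, y i 0 = b].
Proof.
move=> redy; split.
- move=> _ [_ [i <-]]; apply/row_spanP; exists (delta_mx 0 i).
  by rewrite -rowE mxE.
- move=> F c FB sum0 b bF.
  pose a : 'rV[A]_m := \row_i (if (y i 0 : A^o) \in F then c (y i 0) else 0).
  have ay : a *m y = 0.
    apply/matrixP => r l; rewrite [RHS]mxE !ord1 -sum0 mxE.
    transitivity (\sum_i \sum_(b <- F | (y i 0 : A^o) == b) c b *: b).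
      apply: eq_bigr => i _; rewrite big_fset_eq mxE.
      by case: ifP => // _; rewrite mul0r.
    rewrite (exchange_big_dep xpredT) //= big_seq [RHS]big_seq.
    apply: eq_bigr => b' b'F; have [b'0 [i yib']] := FB _ b'F.
    rewrite (big_pred1 i) // => j; rewrite /= -yib'; apply/eqP/eqP => [yji|->//].
    by apply: (reduced_inj redy _ yji); rewrite yji yib'.
  have [b0 [i yib]] := FB _ bF.
  have [|yi0] := redy _ ay i; first by rewrite mxE yib bF.
  by rewrite -yib yi0 eqxx in b0.
move=> v /row_spanP[a ->].
pose F : {fset A^o} := [fset (y i 0 : A^o) | i in 'I_m & y i 0 != 0]%fset.
exists F, (fun b => \sum_(i | y i 0 == b) a 0 i); split.
  by move=> b /= /imfsetP[i /= yi ->]; split; [move: yi; rewrite inE|exists i].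
rewrite mxE.
under [RHS]eq_bigr => b _ do rewrite scaler_suml.
rewrite (exchange_big_dep xpredT) //=; apply: eq_bigr => i _.
have -> : \sum_(b <- F | y i 0 == b) a 0 i *: b =
  if (y i 0 : A^o) \in F then a 0 i *: (y i 0 : A^o) else 0 by exact: big_fset_eq.
case: ifPn => // yiF; have [->|yi] := eqVneq (y i 0) 0; first by rewrite mulr0.
by case/negP: yiF; apply/imfsetP; exists i; rewrite //= inE.
Qed.

End FreeIdeal.

(** * The displacement bound *)

Lemma leq_expn_fact n : (2 ^ n <= n.+1`!)%N.
Proof. by elim: n => // n IHn; rewrite expnS factS leq_mul. Qed.

(** Pair each factor [i] of the factorial with [n + 1 - i]; the product of the
two is at least [n]. *)
Lemma leq_expnn_fact_sqr n : (n ^ n <= n`! ^ 2)%N.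
Proof.
have -> : (n`! ^ 2 = \prod_(1 <= i < n.+1) (i * (n.+1 - i)))%N.
  rewrite big_split /= -fact_prod -mulnn; congr (_ * _)%N.
  by rewrite fact_prod big_nat_rev; apply: eq_bigr.
have {1}-> : (n ^ n = \prod_(1 <= i < n.+1) n)%N.
  by rewrite prod_nat_const_nat subn1.
rewrite big_nat_cond [leqRHS]big_nat_cond; apply: leq_prod => i.
by rewrite andbT => /andP[i1 iN]; nia.
Qed.

Section Main.
Variable R : realType.

Lemma le_log2 (x i j : nat) : (0 < x)%N -> (2 ^ j <= x ^ i)%N ->
  j%:R <= i%:R * log2 (x%:R : R).
Proof.
move=> x0 le_pow; have ln2 : 0 < ln 2 :> R by rewrite ln_gt0 // ltr1n.
rewrite /log2 mulrA ler_pdivlMr // !mulr_natl -!lnXn ?ltr0n //.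
by rewrite ler_ln ?posrE ?exprn_gt0 ?ltr0n // -!natrX ler_nat.
Qed.

(** With [j] the integer part of the binary logarithm of [n + 1], the exponent
[k = j + 3] gives a left-hand side of at most [4 * j * (n + 1) + 39 * n], while
the logarithm of the factorial is at least [n] and [j * (n + 1) / 2]. *)
Lemma log2_fact_bound n : (0 < n)%N -> exists k,
  (3 * n + 2 <= 2 ^ k)%N /\
  n%:R * (2 * (2 + k%:R) + 7) + 4 * (2 + k%:R) + 2 <=
  100 * log2 (n.+1`!%:R : R).
Proof.
move=> n0; have /andP[jn nj] := trunc_log_bounds (ltnSn 1) (ltn0Sn n).
move: (trunc_log 2 n.+1) jn nj => j jn nj; exists j.+3; split.
  by move: nj; rewrite !expnS; lia.
set L := log2 _.
have nL : n%:R <= L.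
  rewrite -[L]mul1r; apply: (@le_log2 _ 1%N); first exact: fact_gt0.
  by rewrite expn1 leq_expn_fact.
have jL : (j * n.+1)%:R <= 2 * L.
  apply: (@le_log2 _ 2%N); first exact: fact_gt0.
  by rewrite expnM; apply: leq_trans (leq_expnn_fact_sqr _); rewrite leq_exp2r.
have n1 : 1 <= n%:R :> R by rewrite ler1n.
move: jL; rewrite natrM -!natr1; have := ler0n R j; nra.
Qed.

Lemma group_algebra_reduction (n : nat) (K : fieldType) (G : groupType)
    (X : metricType R) (act : G -> X -> X) (m : nat) :
  (0 < n)%N -> (m <= n)%N -> hyperbolic X 1 -> isometric_action act ->
  ((100 * log2 (n.+1`!%:R : R))%:E < minimal_displacement act)%E ->
  exists2 mu : group_algebra K G -> R,
    forall x, 0 <= mu x & shrinks_dependent mu m.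
Proof.
move=> n0 mn hypX actX disp; have [_ [pt0 _] _ _ _] := hypX.
exists (spread act pt0); first exact: spread_ge0.
have [k [nk bound]] := log2_fact_bound n0.
have mk : (3 * m + 2 <= 2 ^ k)%N by apply: leq_trans nk; lia.
move=> a x i; apply: (reduction_step hypX pt0 actX mk) => g p g1.
apply: (@le_trans _ _ (100 * log2 (n.+1`!%:R : R))).
  by apply: le_trans bound; rewrite !lerD2r ler_wpM2r ?ler_nat //.
rewrite -lee_fin; apply: (le_trans (ltW disp)).
by apply: ereal_inf_lbound; exists g => //; exists p.
Qed.

End Main.

(** A zero divisor would be a dependent tuple of length one, whose entry shrinks
although there is no other entry to add to it. *)
Lemma shrinks_dependent_domain (A : nzRingType) (R : realType) (mu : A -> R) :
  shrinks_dependent mu 1 -> forall a b : A, a * b = 0 -> a = 0 \/ b = 0.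
Proof.
move=> red a b ab.
have [->|a0] := eqVneq a 0; first by left.
have [->|b0] := eqVneq b 0; first by right.
have [|i [c]] := red (fun=> a) (fun=> b) 0 _ a0 b0; first by rewrite big_ord1.
rewrite big_pred0 => [|j]; last by rewrite !ord1 eqxx.
by rewrite addr0 lerBrDl gerDr ler10.
Qed.

Theorem theorem4 (n : nat) (hn : (1 <= n)%N) (K : fieldType) (G : groupType)
    (R : realType) (X : metricType R) (hX : hyperbolic X 1)
    (act : G -> X -> X) (hact : isometric_action act)
    (hdisp : ((100 * log2 (n.+1`!%:R : R))%:E < minimal_displacement act)%E) :
  (forall I : set (group_algebra K G)^o,
      left_ideal I -> n_generated n I -> free_submodule I) /\
  GE (group_algebra K G) n = GL (group_algebra K G) n.
Proof.
have normal m (x : 'cV[group_algebra K G]_m) : (m <= n)%N ->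
    exists2 P, GE _ m P & reduced (P *m x).
  move=> mn; have [mu mu0 red] := group_algebra_reduction K hn mn hX hact hdisp.
  exact: exists_reduced mu0 red x.
have dom : forall a b : group_algebra K G, a * b = 0 -> a = 0 \/ b = 0.
  have [mu _ red] := group_algebra_reduction K hn hn hX hact hdisp.
  exact: shrinks_dependent_domain red.
split=> [I _ [x ->]|].
  have [P GP redP] := normal n (\col_i x i) (leqnn n).
  exists [set b | b != 0 /\ exists i, (P *m \col_i x i) i 0 = b].
  have := reduced_basis redP; rewrite row_span_GL; last exact: GE_sub_GL.
  congr (is_basis _ _); apply: eq_imagel => a _; apply: eq_bigr => i _.
  by rewrite mxE.
apply/seteqP; split; first exact: GE_sub_GL.
suff GL_GE m : (m <= n)%N -> GL (group_algebra K G) m `<=` GE _ m.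
  exact: GL_GE.
elim: m => [|m IHm] mn; last first.
  by apply: (GL_sub_GE_step dom _ (IHm (ltnW mn))) => x; exact: normal.
by move=> P _; rewrite [P]flatmx0 -[0](flatmx0 1%:M); apply: GE1.
Qed.
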